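(* Let $\Omega=\{1,2,3\}$. There is exactly one association scheme on triples (AST) over $\Omega$ (of any order $m\geq 4$), and its sole nontrivial relation is $\Omega\times\Omega\times\Omega\setminus\bigcup_{i=0}^3 R_i$, where $R_0,R_1,R_2,R_3$ are the trivial relations.
   Context: Let $\Omega$ be a finite set with $|\Omega|=n\geq 3$. An association scheme on triples (AST) of order $m\geq 4$ on (or over) $\Omega$ is a partition $X=\{R_i\}_{i=0}^m$ of $\Omega\times\Omega\times\Omega$ (into $m+1$ nonempty parts) such that: (1) For each $i\in\{0,\ldots,m\}$ there is a constant $n_i^{(3)}\in\mathbb{N}\cup\{0\}$ such that $|\{z\in\Omega : (x,y,z)\in R_i\}|=n_i^{(3)}$ for any pair of distinct $x,y\in\Omega$. (2) For any $i,j,k,l\in\{0,\ldots,m\}$ there is a constant $p_{ijk}^l\in\mathbb{N}\cup\{0\}$ such that $|\{w\in\Omega : (w,y,z)\in R_i,\ (x,w,z)\in R_j,\ (x,y,w)\in R_k\}|=p_{ijk}^l$ for every $(x,y,z)\in R_l$. (3) For any $i\in\{0,\ldots,m\}$ and $\sigma\in S_3$ there is $j\in\{0,\ldots,m\}$ such that $R_i^\sigma:=\{(x_{\sigma(1)},x_{\sigma(2)},x_{\sigma(3)}) : (x_1,x_2,x_3)\in R_i\}=R_j$. (4) The first four relations are the trivial relations $R_0=\{(x,x,x):x\in\Omega\}$, $R_1=\{(y,x,x):x,y\in\Omega,\ x\neq y\}$, $R_2=\{(x,y,x):x,y\in\Omega,\ x\neq y\}$, $R_3=\{(x,x,y):x,y\in\Omega,\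 x\neq y\}$. The relations $R_4,\ldots,R_m$ are called the nontrivial relations. ASTs are treated as unordered partitions. *)

(* Defs.v *)
From mathcomp Require Import all_boot all_fingroup.

Set Implicit Arguments.
Unset Strict Implicit.
Unset Printing Implicit Defensive.

(* T * T * T is encoded as 3.-tuple T, with (x, y, z) = [tuple x; y; z], so
   that 'S_3 acts by permuting the coordinates. *)
Section AST.
Variable T : finType.

Definition triv0 : {set 3.-tuple T} :=
  [set [tuple x; x; x] | x : T].
Definition triv1 : {set 3.-tuple T} :=
  [set [tuple y; x; x] | x in T, y in T & x != y].
Definition triv2 : {set 3.-tuple T} :=
  [set [tuple x; y; x] | x in T, y in T & x != y].
Definition triv3 : {set 3.-tuple T} :=
  [set [tuple x; x; y] | x in T, y in T & x != y].

Definition trivial_relations : {set {set 3.-tuple T}} :=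
  [set triv0; triv1; triv2; triv3].

Definition permute_relation (R : {set 3.-tuple T}) (s : 'S_3) :
    {set 3.-tuple T} :=
  [set [tuple tnth t (s i) | i < 3] | t : 3.-tuple T in R].

(* Schemes are unordered partitions, so the conditions quantify over the parts
   themselves instead of over indices; order m means m + 1 parts, and the four
   trivial relations are required to be parts.  The parts are nonempty because
   partition excludes set0. *)
Record is_AST (m : nat) (X : {set {set 3.-tuple T}}) : Prop := IsAST {
  AST_card_ge3 : 3 <= #|T|;
  AST_order_ge4 : 4 <= m;
  AST_partition : partition X [set: 3.-tuple T];
  AST_order : #|X| = m.+1;
  AST_valency : forall A, A \in X ->
    exists n3 : nat, forall x y : T, x != y ->
      #|[set z | [tuple x; y; z] \in A]| = n3;
  AST_intersection : forall A B C D,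
    A \in X -> B \in X -> C \in X -> D \in X ->
    exists p : nat, forall x y z : T, [tuple x; y; z] \in D ->
      #|[set w | [&& [tuple w; y; z] \in A,
                     [tuple x; w; z] \in B &
                     [tuple x; y; w] \in C]]| = p;
  AST_perm : forall A (s : 'S_3), A \in X -> permute_relation A s \in X;
  AST_trivial : trivial_relations \subset X
}.

Definition nontrivial_relations (X : {set {set 3.-tuple T}}) :
    {set {set 3.-tuple T}} :=
  X :\: trivial_relations.

End AST.

Arguments triv0 T : clear implicits.
Arguments triv1 T : clear implicits.
Arguments triv2 T : clear implicits.
Arguments triv3 T : clear implicits.
Arguments trivial_relations T : clear implicits.

(* Main.v *)
Require Import Defs.
From mathcomp Require Import all_boot all_fingroup.
From mathcomp Require Import primitive_action alt.

Set Implicit Arguments.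
Unset Strict Implicit.
Unset Printing Implicit Defensive.

(** The symmetric group of the point set T acts diagonally on triples, and the
    orbit of a triple is determined by which of its coordinates are equal
    ([mem_triple_orbit]), because Sym(T) is k-transitive for every k.  Hence,
    when T has at least three points, there are five orbits: the four trivial
    relations and the set of triples of distinct points ([triple_orbitsE]).
    They form a scheme ([triple_orbits_AST]): valencies are constant by 2-transitivity,
    intersection numbers are constant because the counted sets of two triples
    in one orbit are exchanged by a permutation of T, and permuting
    coordinates commutes with the diagonal action.

    Conversely, let Y be any scheme on three points and A a part of Y that
    contains a triple of distinct points.  Then A has positive valency, so for
    each pair of distinct points x, y some (x, y, z) lies in A; this z is
    necessarily the third point, as A is disjoint from the trivial relations.
    So A contains all triples of distinct points, and Y is the orbit scheme
    ([AST_card3]). *)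

(** * Triples up to permutations of the points *)

Section TripleOrbits.
Local Open Scope group_scope.
Variable T : finType.
Implicit Types (x y z : T) (t u : 3.-tuple T) (g : {perm T}).
Implicit Types (A B : {set 3.-tuple T}).

Definition nontriv : {set 3.-tuple T} :=
  [set: 3.-tuple T] :\: (triv0 T :|: triv1 T :|: triv2 T :|: triv3 T).

Definition triple_orbits : {set {set 3.-tuple T}} :=
  orbit ('P * 3) [set: {perm T}] @: [set: 3.-tuple T].

Lemma tripleP (P : 3.-tuple T -> Prop) :
  (forall x y z, P [tuple x; y; z]) -> forall t, P t.
Proof.
move=> Pxyz; case/tupleP=> x; case/tupleP=> y; case/tupleP=> z t.
rewrite (tuple0 t).
have -> : [tuple of x :: [tuple of y :: [tuple of z :: [tuple]]]]
          = [tuple x; y; z] by apply: val_inj.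
exact: Pxyz.
Qed.

Lemma eq_triple x y z x' y' z' :
  ([tuple x; y; z] == [tuple x'; y'; z']) = [&& x == x', y == y' & z == z'].
Proof. by rewrite -val_eqE /= !eqseq_cons eqxx andbT. Qed.

Lemma in_triv0 x y z : ([tuple x; y; z] \in triv0 T) = (x == y) && (y == z).
Proof.
apply/imsetP/andP => [[a _ /eqP]|[/eqP-> /eqP->]]; last by exists z.
by rewrite eq_triple => /and3P[/eqP-> /eqP-> /eqP->].
Qed.

Lemma in_triv1 x y z : ([tuple x; y; z] \in triv1 T) = (y == z) && (x != y).
Proof.
apply/imset2P/andP => [[a b _]|[/eqP-> xz]].
  rewrite inE => /andP[_ ab] /eqP; rewrite eq_triple.
  by move=> /and3P[/eqP-> /eqP-> /eqP->]; rewrite eq_sym.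
by exists z x => //; rewrite inE /= eq_sym.
Qed.

Lemma in_triv2 x y z : ([tuple x; y; z] \in triv2 T) = (x == z) && (x != y).
Proof.
apply/imset2P/andP => [[a b _]|[/eqP-> xz]].
  rewrite inE => /andP[_ ab] /eqP; rewrite eq_triple.
  by move=> /and3P[/eqP-> /eqP-> /eqP->].
by exists z y => //; rewrite inE.
Qed.

Lemma in_triv3 x y z : ([tuple x; y; z] \in triv3 T) = (x == y) && (x != z).
Proof.
apply/imset2P/andP => [[a b _]|[/eqP-> xz]].
  rewrite inE => /andP[_ ab] /eqP; rewrite eq_triple.
  by move=> /and3P[/eqP-> /eqP-> /eqP->].
by exists y z => //; rewrite inE.
Qed.

Lemma in_nontriv x y z :
  ([tuple x; y; z] \in nontriv) = [&& x != y, y != z & x != z].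
Proof.
rewrite !inE in_triv0 in_triv1 in_triv2 in_triv3 andbT.
have [-> | xy] := eqVneq x y; first by case: eqVneq.
by case: (y == z); case: (x == z).
Qed.

Definition in_relations := (in_triv0, in_triv1, in_triv2, in_triv3, in_nontriv).

(** Sym(T) is transitive on lists of distinct points of any length up to the
    cardinality of T, and no such list is longer. *)
Lemma perm_map_uniq n (t u : n.-tuple T) :
  uniq t -> uniq u -> exists g, map g t = u.
Proof.
move=> Ut Uu.
have le_n : n <= #|T| by rewrite -(card_uniq_tuple Ut) max_card.
have tr := ntransitive_weak le_n (Sym_trans T).
have all_in (v : n.-tuple T) : uniq v -> v \in n.-dtuple([set: T]).
  by move=> Uv; rewrite inE Uv; apply/subsetP => i _; rewrite inE.
have [g _ def_u] := atransP2 tr (all_in t Ut) (all_in u Uu).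
by exists g; rewrite def_u.
Qed.

Lemma triple_orbitP t x y z :
  reflect (exists g, t = [tuple g x; g y; g z])
          (t \in orbit ('P * 3) [set: {perm T}] [tuple x; y; z]).
Proof.
apply: (iffP imsetP) => [[g _ ->] | [g ->]]; exists g => //; exact: val_inj.
Qed.

Lemma mem_triple_orbit x y z x' y' z' :
  ([tuple x'; y'; z'] \in orbit ('P * 3) [set: {perm T}] [tuple x; y; z])
    = [&& (x' == y') == (x == y), (y' == z') == (y == z)
        & (x' == z') == (x == z)].
Proof.
apply/triple_orbitP/and3P => [[g /eqP]|].
  rewrite eq_triple => /and3P[/eqP-> /eqP-> /eqP->].
  by rewrite !(inj_eq perm_inj).
(* Each equality pattern reduces to transitivity on the distinct coordinates. *)
case: (eqVneq x y) => [-> | xy] [/eqP exy /eqP eyz /eqP exz].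
  move/eqP: exy => exy; rewrite {}exy {x'} in exz *.
  case: (eqVneq y z) eyz => [<- /eqP-> | yz /negbT yz'].
    by exists (tperm y z'); rewrite tpermL.
  have [||g [gy gz]] := @perm_map_uniq 2 [tuple y; z] [tuple y'; z'].
  - by rewrite /= inE yz.
  - by rewrite /= inE yz'.
  by exists g; rewrite gy gz.
case: (eqVneq y z) eyz => [<- /eqP<- | yz /negbT yz'].
  have [||g [gx gy]] := @perm_map_uniq 2 [tuple x; y] [tuple x'; y'].
  - by rewrite /= inE xy.
  - by rewrite /= inE exy.
  by exists g; rewrite gx gy.
case: (eqVneq x z) exz => [<- /eqP<- | xz /negbT xz'].
  have [||g [gx gy]] := @perm_map_uniq 2 [tuple x; y] [tuple x'; y'].
  - by rewrite /= inE xy.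
  - by rewrite /= inE exy.
  by exists g; rewrite gx gy.
have [||g [gx gy gz]] := @perm_map_uniq 3 [tuple x; y; z] [tuple x'; y'; z'].
- by rewrite /= !inE negb_or xy xz yz.
- by rewrite /= !inE negb_or exy xz' yz'.
by exists g; rewrite gx gy gz.
Qed.

(** Two equalities among three points force the third; this excludes the
    Boolean patterns that no triple realizes. *)
Lemma eq_trans3 x y z :
  [&& (x == y) && (y == z) ==> (x == z), (x == y) && (x == z) ==> (y == z)
    & (y == z) && (x == z) ==> (x == y)].
Proof.
by apply/and3P; split; apply/implyP => /andP[/eqP-> /eqP->].
Qed.

Lemma triple_orbitE x y z :
  orbit ('P * 3) [set: {perm T}] [tuple x; y; z] =
    if x == y then if y == z then triv0 T else triv3 T
    else if y == z then triv1 T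
    else if x == z then triv2 T else nontriv.
Proof.
apply/setP; apply: tripleP => x' y' z'; rewrite mem_triple_orbit.
have := eq_trans3 x' y' z'; have := eq_trans3 x y z.
case: (x == y); case: (y == z); case: (x == z) => //= _; rewrite in_relations;
  by case: (x' == y'); case: (y' == z'); case: (x' == z').
Qed.

Lemma triple_orbitsE :
  2 < #|T| -> triple_orbits = nontriv |: trivial_relations T.
Proof.
case/card_gt2P=> a [b [c [_ [ab bc ca]]]]; rewrite eq_sym in ca.
apply/setP=> A; apply/imsetP/idP => [[t _ ->] |].
  elim/tripleP: t => x y z; rewrite triple_orbitE !inE.
  by case: (x == y); case: (y == z); case: (x == z); rewrite eqxx ?orbT.
rewrite !inE -!orbA => /or4P[/eqP->|/eqP->|/eqP->|/orP[]/eqP->].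
- exists [tuple a; b; c] => //.
  by rewrite triple_orbitE (negPf ab) (negPf bc) (negPf ca).
- by exists [tuple a; a; a]; rewrite ?triple_orbitE ?eqxx.
- exists [tuple a; b; b] => //.
  by rewrite triple_orbitE (negPf ab) eqxx.
- exists [tuple a; b; a] => //.
  by rewrite triple_orbitE (negPf ab) eq_sym (negPf ab) eqxx.
- exists [tuple a; a; b] => //.
  by rewrite triple_orbitE (negPf ab) eqxx.
Qed.

(** The five relations are told apart by which of five sample triples, one of
    each kind, they contain. *)
Lemma uniq_relations :
  2 < #|T| -> uniq [:: nontriv; triv0 T; triv1 T; triv2 T; triv3 T].
Proof.
case/card_gt2P=> a [b [c [_ [ab bc ca]]]]; rewrite eq_sym in ca.
pose samples := [:: [tuple a; b; c]; [tuple a; a; a]; [tuple b; a; a];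
                    [tuple a; b; a]; [tuple a; a; b]].
pose kinds (A : {set 3.-tuple T}) := [seq t \in A | t <- samples].
apply: (@map_uniq _ _ kinds).
rewrite /kinds /= !in_relations eqxx (eq_sym b a).
by rewrite (negPf ab) (negPf bc) (negPf ca).
Qed.

Lemma card_relations : 2 < #|T| -> #|nontriv |: trivial_relations T| = 5.
Proof.
move=> T3; have /card_uniqP/= <- := uniq_relations T3.
by apply: eq_card => A; rewrite !inE -!orbA.
Qed.

Lemma nontriv_notin_trivial :
  2 < #|T| -> nontriv \notin trivial_relations T.
Proof. by move/uniq_relations => /= /andP[]; rewrite !inE -!orbA. Qed.

(** * The orbits form a scheme *)

Lemma mem_permuted_triple A g x y z :
  A \in triple_orbits ->
  ([tuple g x; g y; g z] \in A) = ([tuple x; y; z] \in A).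
Proof.
case/imsetP=> t _ ->; elim/tripleP: t => a b c.
by rewrite !mem_triple_orbit !(inj_eq perm_inj).
Qed.

(** Moving the points and permuting the coordinates commute. *)
Lemma permute_relation_orbit t (s : 'S_3) :
  permute_relation (orbit ('P * 3) [set: {perm T}] t) s =
  orbit ('P * 3) [set: {perm T}] [tuple tnth t (s i) | i < 3].
Proof.
apply/setP=> u; apply/imsetP/imsetP.
  case=> _ /imsetP[g Gg ->] ->; exists g => //.
  by apply: eq_from_tnth => i; rewrite !(tnth_mktuple, tnth_map).
case=> g Gg ->; exists (n_act 'P t g); first exact: imset_f.
by apply: eq_from_tnth => i; rewrite !(tnth_mktuple, tnth_map).
Qed.

Lemma triple_orbits_partition : partition triple_orbits [set: 3.-tuple T].
Proof.
by apply: orbit_partition; apply/actsP => g _ t; rewrite !inE.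
Qed.

(** Both counting conditions compare two sets of points that a permutation g
    maps onto each other: for valencies g comes from 2-transitivity on the pairs
    (x, y), for intersection numbers from x, y, z and a, b, c being in the same
    orbit. *)
Lemma triple_orbits_AST : 2 < #|T| -> is_AST 4 triple_orbits.
Proof.
move=> T3; split=> //.
- exact: triple_orbits_partition.
- by rewrite triple_orbitsE // card_relations.
- move=> A XA.
  case/card_gt2P: (T3) => a [b [_ [_ [ab _ _]]]].
  exists #|[set z | [tuple a; b; z] \in A]| => x y xy.
  have [||g [<- <-]] := @perm_map_uniq 2 [tuple a; b] [tuple x; y].
  + by rewrite /= inE ab.
  + by rewrite /= inE xy.
  rewrite -[RHS](card_imset _ (@perm_inj _ g)); apply: eq_card => z.
  by rewrite -[z](permKV g) mem_imset ?inE ?mem_permuted_triple //; apply: perm_inj.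
- move=> A B C D XA XB XC /imsetP[t _ ->]; elim/tripleP: t => a b c.
  exists #|[set w | [&& [tuple w; b; c] \in A, [tuple a; w; c] \in B
                     & [tuple a; b; w] \in C]]| => x y z.
  case/triple_orbitP => g /eqP; rewrite eq_triple => /and3P[/eqP-> /eqP-> /eqP->].
  rewrite -[RHS](card_imset _ (@perm_inj _ g)); apply: eq_card => w.
  by rewrite -[w](permKV g) mem_imset ?inE ?mem_permuted_triple //; apply: perm_inj.
- by move=> A s /imsetP[t _ ->]; rewrite permute_relation_orbit imset_f.
- by rewrite triple_orbitsE // subsetUr.
Qed.

(** * Schemes on three points *)

(** A pair of distinct points has a single third point, so positive valency
    puts all triples of distinct points into one part. *)
Lemma AST_card3_nontriv m (Y : {set {set 3.-tuple T}}) :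
  #|T| = 3 -> is_AST m Y -> nontriv \in Y.
Proof.
move=> T3 [_ _ partY _ valY _ _ trivY].
have tiY := partition_trivIset partY.
have [a [b [c [_ [ab bc ca]]]]] : exists a b c : T,
    [/\ a \in T, b \in T & c \in T] /\ [/\ a != b, b != c & c != a].
  by apply/card_gt2P; rewrite T3.
have Yabc : [tuple a; b; c] \in cover Y by rewrite (cover_partition partY) inE.
have Dabc : [tuple a; b; c] \in nontriv.
  by rewrite in_nontriv ab bc eq_sym ca.
pose A := pblock Y [tuple a; b; c].
have YA : A \in Y by apply: pblock_mem.
have Aabc : [tuple a; b; c] \in A by rewrite mem_pblock.
have sAD : A \subset nontriv.
  apply/subsetP=> t At; rewrite in_setD in_setT andbT; apply/negP => trt.
  have [B trB Bt] : exists2 B, B \in trivial_relations T & t \in B.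
    move: trt; rewrite !in_setU -!orbA => /or4P[] Bt;
      by [exists (triv0 T) => //; rewrite !inE eqxx |
          exists (triv1 T) => //; rewrite !inE eqxx ?orbT |
          exists (triv2 T) => //; rewrite !inE eqxx ?orbT |
          exists (triv3 T) => //; rewrite !inE eqxx ?orbT].
  have YB := subsetP trivY B trB.
  have eAB : A = B by rewrite -(def_pblock tiY YA At) (def_pblock tiY YB Bt).
  move: trB Dabc; rewrite -eAB !inE -!orbA.
  by case/or4P => /eqP <-; rewrite Aabc ?orbT.
have [n nA] := valY A YA.
suff <- : A = nontriv by [].
apply/eqP; rewrite eqEsubset sAD; apply/subsetP; apply: tripleP => x y z.
rewrite in_nontriv => /and3P[xy yz xz].
have : 0 < #|[set w | [tuple x; y; w] \in A]|.
  by rewrite nA // -(nA a b ab) card_gt0; apply/set0Pn; exists c; rewrite inE.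
rewrite card_gt0 => /set0Pn[w]; rewrite inE => Aw.
have := subsetP sAD _ Aw; rewrite in_nontriv => /and3P[_ yw xw].
(* Otherwise x, y, z and w would be four distinct points. *)
suff -> : z = w by [].
apply/eqP; apply: contraTT isT => zw.
have /card_uniqP/= sz : uniq [:: x; y; z; w].
  by rewrite /= !inE !negb_or xy xz xw yz yw zw.
by have := max_card [in [:: x; y; z; w]]; rewrite sz T3.
Qed.

(** All five relations are parts of Y, and they already cover every triple. *)
Lemma AST_card3 m (Y : {set {set 3.-tuple T}}) :
  #|T| = 3 -> is_AST m Y -> Y = nontriv |: trivial_relations T.
Proof.
move=> T3 astY; have YD := AST_card3_nontriv T3 astY.
case: astY => _ _ partY _ _ _ _ trivY.
have T3' : 2 < #|T| by rewrite T3.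
have partX := triple_orbits_partition; rewrite triple_orbitsE // in partX.
have sXY : nontriv |: trivial_relations T \subset Y by rewrite subUset sub1set YD.
apply/eqP; rewrite eqEsubset sXY andbT; apply/subsetP => B YB.
have /set0Pn[t Bt] := partition_neq0 partY YB.
have /bigcupP[A XA At] : t \in cover (nontriv |: trivial_relations T).
  by rewrite (cover_partition partX) inE.
have tiY := partition_trivIset partY.
by rewrite -(def_pblock tiY YB Bt) (def_pblock tiY (subsetP sXY A XA) At).
Qed.

End TripleOrbits.

Theorem mainTheorem2 :
  exists X : {set {set 3.-tuple 'I_3}},
    unique (fun Y : {set {set 3.-tuple 'I_3}} => exists m : nat, is_AST m Y) X
    /\ nontrivial_relations X =
       [set [set: 3.-tuple 'I_3]
              :\: (triv0 'I_3 :|: triv1 'I_3 :|: triv2 'I_3 :|: triv3 'I_3)].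
Proof.
have T3 : #|'I_3| = 3 := card_ord 3.
have T3' : 2 < #|'I_3| by rewrite T3.
exists (nontriv 'I_3 |: trivial_relations 'I_3); split.
  split; first by exists 4; rewrite -triple_orbitsE //; apply: triple_orbits_AST.
  by move=> Y [m /(AST_card3 T3)].
apply/setP => A; rewrite in_setD in_setU1 in_set1 andb_orr andNb orbF.
by rewrite andbC; case: eqP => // ->; rewrite nontriv_notin_trivial.
Qed.
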